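(* Let $0<M<N$ be integers, let $a_{ij}\in\mathbb{R}$ ($i=1,\dots,M$, $j=1,\dots,N$) and $g_i\in\mathbb{R}$ ($i=1,\dots,M$) be given, and assume that $$\sum_{j=1}^N a_{ij}\ge 0,\quad i=1,\dots,M,\qquad\qquad \sum_{i,j=1}^M v_i\,a_{ij}\,v_j>0\quad\forall\,(v_1,\dots,v_M)\in\mathbb{R}^M\setminus\{0\}.$$ Let index sets $S_i$ satisfy $\{j\in\{1,\dots,N\}\setminus\{i\}\,;\,a_{ij}\neq0\}\subset S_i\subset\{1,\dots,N\}\setminus\{i\}$ for $i=1,\dots,M$. For every $\mathrm{U}\in\mathbb{R}^N$ let $\mathbb{B}(\mathrm{U})=(b_{ij}(\mathrm{U}))_{i,j=1}^N$ be a real matrix such that, for all $\mathrm{U}$: $b_{ij}(\mathrm{U})=b_{ji}(\mathrm{U})$ for $i,j=1,\dots,N$; $b_{ij}(\mathrm{U})\le 0$ for $i\ne j$, $i,j=1,\dots,N$; $\sum_{j=1}^N b_{ij}(\mathrm{U})=0$ for $i=1,\dots,N$; and $b_{ij}(\mathrm{U})=0$ for all $i=1,\dots,M$ and $j\notin S_i\cup\{i\}$. Assume: (A1) for any $i\in\{1,\dots,M\}$ and $j\in\{1,\dots,N\}$, the function $\mathrm{U}=(u_1,\dots,u_N)\mapsto b_{ij}(\mathrm{U})(u_j-u_i)$ is continuous on $\mathbb{R}^N$, and for any $i\in\{1,\dots,M\}$ and $j\in\{M+1,\dots,N\}$, the function $b_{ij}$ is bounded on $\mathbb{R}^N$; (A2)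 for any $\mathrm{U}=(u_1,\dots,u_N)\in\mathbb{R}^N$ and any $i\in\{1,\dots,M\}$, if either $u_i>u_j$ for all $j\in S_i$ or $u_i<u_j$ for all $j\in S_i$, then $a_{ij}+b_{ij}(\mathrm{U})\le0$ for all $j\in S_i$. Let $\mathrm{U}=(u_1,\dots,u_N)\in\mathbb{R}^N$ be any vector satisfying $\sum_{j=1}^N (a_{ij}+b_{ij}(\mathrm{U}))\,u_j=g_i$ for $i=1,\dots,M$. Then $$g_i\le 0,\ i=1,\dots,M\quad\Rightarrow\quad \max_{i=1,\dots,N}u_i\le\max_{i=M+1,\dots,N}u_i^+,$$ $$g_i\ge 0,\ i=1,\dots,M\quad\Rightarrow\quad \min_{i=1,\dots,N}u_i\ge\min_{i=M+1,\dots,N}u_i^-.$$ If, in addition, $\sum_{j=1}^N a_{ij}=0$ for $i=1,\dots,M$, then $$g_i\le 0,\ i=1,\dots,M\quad\Rightarrow\quad \max_{i=1,\dots,N}u_i=\max_{i=M+1,\dots,N}u_i,$$ $$g_i\ge 0,\ i=1,\dots,M\quad\Rightarrow\quad \min_{i=1,\dots,N}u_i=\min_{i=M+1,\dots,N}u_i.$$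
   Context: For a real number $a$, $a^+=\max\{a,0\}$ and $a^-=\min\{a,0\}$. *)

(* Defs.v *)
From HB Require Import structures.
From mathcomp Require Import all_boot all_order all_algebra.
From mathcomp Require Import all_classical all_reals all_analysis.

Set Implicit Arguments.
Unset Strict Implicit.
Unset Printing Implicit Defensive.

Import Order.TTheory GRing.Theory Num.Theory.
Import numFieldNormedType.Exports.

Local Open Scope ring_scope.

(* Indices are 0-based: 'I_N plays the role of {1, ..., N}, its elements of
   value < M that of {1, ..., M}, and those of value >= M that of
   {M+1, ..., N}. *)
Definition row_idx (M N : nat) (ltMN : (M < N)%N) : 'I_M -> 'I_N :=
  widen_ord (ltnW ltMN).

Definition pos_part (R : realType) (x : R) : R := Num.max x 0.

(* x^- = min(x, 0) is nonpositive, unlike the library's f^\-. *)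
Definition neg_part (R : realType) (x : R) : R := Num.min x 0.

(* The maximum is taken in the extended reals so as to need no default value;
   it is finite, and equal to the real maximum, when P is nonempty. *)
Definition max_over (R : realType) (N : nat) (P : pred 'I_N)
    (f : 'I_N -> R) : \bar R :=
  \big[maxe/-oo%E]_(i < N | P i) (f i)%:E.

Definition min_over (R : realType) (N : nat) (P : pred 'I_N)
    (f : 'I_N -> R) : \bar R :=
  \big[mine/+oo%E]_(i < N | P i) (f i)%:E.

(* Main.v *)
Require Import Defs.
From HB Require Import structures.
From mathcomp Require Import all_boot all_order all_algebra.
From mathcomp Require Import all_classical all_reals all_analysis.
From mathcomp Require Import lra.

Set Implicit Arguments.
Unset Strict Implicit.
Unset Printing Implicit Defensive.

Import Order.TTheory GRing.Theory Num.Theory.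
Import numFieldNormedType.Exports.

Local Open Scope ring_scope.

(* At U + t c e_k with t > 0 the k-th entry is a strict local extremum, so (A2)
   applies there; the resulting sign passes to the limit t -> 0+ although b
   itself need not be continuous, because b V * (V_j - V_k) is. *)
Lemma weak_extremum_sign (R : realType) (N : nat) (k j : 'I_N) (T : {set 'I_N})
    (a c : R) (b : 'rV[R]_N -> R) (U : 'rV[R]_N) :
  k \notin T -> j \in T ->
  continuous (fun V : 'rV[R]_N => b V * (V 0 j - V 0 k)) ->
  (forall V : 'rV[R]_N,
     (forall l, l \in T -> V 0 l < V 0 k) \/
     (forall l, l \in T -> V 0 k < V 0 l) ->
     a + b V <= 0) ->
  c != 0 -> (forall l, l \in T -> 0 <= c * (U 0 k - U 0 l)) ->
  0 <= c * ((a + b U) * (U 0 j - U 0 k)).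
Proof.
move=> kT jT b_cont b_sgn c_neq0 Uext.
pose V (t : R) : 'rV[R]_N := U + t *: (c *: delta_mx 0 k).
have V0 : V 0 = U by rewrite /V scale0r addr0.
have VkE t : V t 0 k = U 0 k + t * c by rewrite !mxE !eqxx mulr1.
have VlE t l : l \in T -> V t 0 l = U 0 l.
  move=> lT; rewrite !mxE eqxx /=.
  have -> : (l == k) = false by apply: contraNF kT => /eqP <-.
  by rewrite !mulr0 addr0.
have V_cont : {for 0, continuous V}.
  apply: continuousD; first exact: cvg_cst.
  by apply: continuousZr_tmp; exact: cvg_id.
(* [F t] equals [c * ((a + b (V t)) * (V t 0 j - V t 0 k))]. The [a] part is expanded as an explicit
   polynomial in [t], so that the only factor involving [b] is the product assumed continuous. *)
pose F (t : R) := c * (a * (U 0 j - (U 0 k + t * c))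
                       + b (V t) * (V t 0 j - V t 0 k)).
have F_cont : {for 0, continuous F}.
  apply: continuousM; first exact: cvg_cst.
  apply: continuousD.
    apply: continuousM; first exact: cvg_cst.
    apply: continuousB; first exact: cvg_cst.
    apply: continuousD; first exact: cvg_cst.
    by apply: continuousM; [exact: cvg_id | exact: cvg_cst].
  exact: (@continuous_comp _ _ _ V
    (fun W : 'rV[R]_N => b W * (W 0 j - W 0 k)) _ V_cont (b_cont _)).
have F0E : F 0 = c * ((a + b U) * (U 0 j - U 0 k)).
  by rewrite /F V0 mul0r addr0 -mulrDl.
rewrite -F0E.
have F_cvg : (F t @[t --> 0^'+] --> F 0)%classic by exact: cvg_at_right_filter.
apply: (cvgr_to_ge F_cvg).
near=> t.
have t_gt0 : 0 < t by near: t; exact: nbhs_right_gt.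
have c2 : 0 < t * (c * c) by rewrite mulr_gt0 // -expr2 exprn_even_gt0.
(* The left factor is [c * (U 0 k - U 0 l) + t * c ^ 2]: the weak inequality at [U] becomes strict,
   whatever the sign of [c]. *)
have Vext l : l \in T -> 0 < c * (V t 0 k - V t 0 l).
  move=> lT; rewrite VkE VlE //.
  by have := Uext l lT; move: c2; clear; nra.
(* The sign of [c] selects the alternative: a strict maximum for [c > 0], a strict minimum for
   [c < 0]. *)
have abV : a + b (V t) <= 0.
  have [c_gt0|c_lt0|c0] := ltgtP 0 c; last by rewrite c0 eqxx in c_neq0.
  - by apply: b_sgn; left=> l /Vext; rewrite pmulr_rgt0 // subr_gt0.
  - by apply: b_sgn; right=> l /Vext; rewrite nmulr_rgt0 // subr_lt0.
rewrite /F -VkE -(VlE t j) // -mulrDl.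
by have := Vext j jT; move: abV; clear; nra.
Unshelve. all: by end_near.
Qed.

(* If the maximum s were attained only on rows i < M, say on the set J, then
   for i in J all terms (a_ij + b_ij) (u_j - s) >= 0 would vanish, so row i of
   a + b would sum to 0 over J.  As row i of b has a nonnegative sum over J,
   that of a has a nonpositive one, against positivity of the quadratic form
   of a at the indicator vector of J. *)
Lemma max_attained_outside_rows (R : realType) (M N : nat) (ltMN : (M < N)%N)
    (a b : 'M[R]_(M, N)) (u : 'I_N -> R) (k0 : 'I_N) :
  (forall i, 0 <= \sum_(j < N) a i j) ->
  (forall v : 'rV[R]_M, v != 0 ->
     0 < \sum_(i < M) \sum_(j < M) v 0 i * a i (row_idx ltMN j) * v 0 j) ->
  (forall i j, row_idx ltMN i != j -> b i j <= 0) ->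
  (forall i, \sum_(j < N) b i j = 0) ->
  (forall i, (forall j, u j <= u (row_idx ltMN i)) ->
     forall j, 0 <= (a i j + b i j) * (u j - u (row_idx ltMN i))) ->
  (forall i, \sum_(j < N) (a i j + b i j) * u j <= 0) ->
  (forall j, u j <= u k0) ->
  0 < u k0 \/ (forall i, \sum_(j < N) a i j = 0) ->
  exists2 k : 'I_N, (M <= k)%N & u k = u k0.
Proof.
move=> a_row_ge0 a_posdef b_le0 b_row0 ab_sgn ab_sol u_le hs.
have [/existsP[k /andP[Mk /eqP uk]]|noK] :=
  boolP [exists k : 'I_N, (M <= k)%N && (u k == u k0)]; first by exists k.
pose s := u k0.
have in_row (j : 'I_N) : u j = s -> exists i, j = row_idx ltMN i.
  move=> uj; have jM : (j < M)%N.
    rewrite ltnNge; apply: contra noK => Mj.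
    by apply/existsP; exists j; rewrite Mj uj eqxx.
  by exists (Ordinal jM); exact: val_inj.
pose v : 'rV[R]_M := \row_i (u (row_idx ltMN i) == s)%:R.
have v_neq0 : v != 0.
  have [i0 k0E] := in_row k0 erefl.
  apply/eqP => /rowP /(_ i0); rewrite !mxE -k0E eqxx => /eqP.
  by rewrite oner_eq0.
(* Row [i] enters the quadratic form with the factor [v 0 i], so only rows where the maximum is
   attained contribute. *)
suff row_le0 i : u (row_idx ltMN i) = s ->
    \sum_(j < M) a i (row_idx ltMN j) * v 0 j <= 0.
  have := a_posdef v v_neq0; rewrite ltNge => /negP; case.
  apply: sumr_le0 => i _; rewrite mxE.
  have [ui|_] := eqVneq (u (row_idx ltMN i)) s.
    by under eq_bigr do rewrite mul1r; exact: row_le0.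
  by rewrite big1 // => j _; rewrite !mul0r.
move=> ui.
(* Reindexing from ['I_M] to ['I_N] loses nothing, because by [in_row] every maximiser is a row
   index. *)
have sumJ : \sum_(j < M) a i (row_idx ltMN j) * v 0 j
            = \sum_(j < N | u j == s) a i j.
  transitivity (\sum_(j < M | u (row_idx ltMN j) == s) a i (row_idx ltMN j)).
    rewrite [RHS]big_mkcond; apply: eq_bigr => j _; rewrite mxE.
    by case: ifP => _; rewrite ?mulr1 ?mulr0.
  have row_inj : injective (row_idx ltMN).
    by move=> x y /(congr1 val) xy; exact: val_inj.
  rewrite -(big_imset (fun j => a i j) (in2W row_inj)) /=.
  apply: eq_bigl => j; apply/imsetP/eqP.
    by case=> x; rewrite unfold_in => /eqP ? ->.
  move=> uj; have [x xE] := in_row j uj; exists x => //.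
  by rewrite unfold_in -xE uj; exact: eqxx.
have u_max j : u j <= u (row_idx ltMN i) by rewrite ui.
have term_ge0 j : 0 <= (a i j + b i j) * (u j - s).
  by rewrite -ui; exact: ab_sgn.
have abE : \sum_j (a i j + b i j) = \sum_j a i j.
  by rewrite big_split /= b_row0 addr0.
have sumE : \sum_j (a i j + b i j) * (u j - s)
    = \sum_j (a i j + b i j) * u j - s * \sum_j a i j.
  rewrite -abE mulr_sumr -sumrB.
  by apply: eq_bigr => j _; rewrite mulrBr [s * _]mulrC.
have sum_ge0 : 0 <= \sum_j (a i j + b i j) * (u j - s) by apply: sumr_ge0.
(* For [s > 0], [sumE] gives [s * \sum_j a i j <= \sum_j (a i j + b i j) * u j <= 0], hence a
   nonpositive row sum of [a]. *)
have a_sum0 : \sum_j a i j = 0.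
  case: hs => [s_gt0|->//].
  apply/eqP; rewrite eq_le a_row_ge0 andbT -(pmulr_rle0 _ s_gt0).
  by move: sum_ge0; rewrite sumE; have := ab_sol i; rewrite -/s; lra.
have terms0 : \sum_j (a i j + b i j) * (u j - s) = 0.
  by apply/eqP; rewrite eq_le sum_ge0 andbT sumE a_sum0 mulr0 subr0.
have ab0 j : u j != s -> a i j + b i j = 0.
  move=> uj; have /(_ j isT)/eqP := psumr_eq0P (fun j _ => term_ge0 j) terms0.
  by rewrite mulf_eq0 subr_eq0 (negbTE uj) orbF => /eqP.
rewrite sumJ.
have splitb : \sum_(j | u j == s) b i j = - \sum_(j | u j != s) b i j.
  apply/eqP; rewrite -addr_eq0; apply/eqP; rewrite -[RHS](b_row0 i).
  by rewrite [RHS](bigID (fun j => u j == s)).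
have splitab : \sum_(j | u j == s) a i j + \sum_(j | u j == s) b i j = 0.
  rewrite -[RHS]a_sum0 -abE [RHS](bigID (fun j => u j == s)) /= -big_split /=.
  by rewrite [X in _ = _ + X]big1 ?addr0 // => j /ab0.
(* Since [u] equals [s] at row [i], an index with [u j != s] is off the diagonal. *)
have : \sum_(j | u j != s) b i j <= 0.
  apply: sumr_le0 => j uj; apply: b_le0.
  by apply: contraNneq uj => <-; apply/eqP.
by move: splitab; rewrite splitb; lra.
Qed.

Theorem corollary1 (R : realType) (M N : nat)
    (gt0M : (0 < M)%N) (ltMN : (M < N)%N)
    (a : 'M[R]_(M, N)) (g : 'I_M -> R)
    (a_row_ge0 : forall i : 'I_M, 0 <= \sum_(j < N) a i j)
    (a_posdef : forall v : 'rV[R]_M, v != 0 ->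
       0 < \sum_(i < M) \sum_(j < M) v 0 i * a i (row_idx ltMN j) * v 0 j)
    (S : 'I_M -> {set 'I_N})
    (S_lower : forall (i : 'I_M) (j : 'I_N),
       j != row_idx ltMN i -> a i j != 0 -> j \in S i)
    (S_upper : forall i : 'I_M, row_idx ltMN i \notin S i)
    (b : 'rV[R]_N -> 'M[R]_N)
    (b_sym : forall (U : 'rV[R]_N) (i j : 'I_N), b U i j = b U j i)
    (b_offdiag : forall (U : 'rV[R]_N) (i j : 'I_N), i != j -> b U i j <= 0)
    (b_row0 : forall (U : 'rV[R]_N) (i : 'I_M),
       \sum_(j < N) b U (row_idx ltMN i) j = 0)
    (b_supp : forall (U : 'rV[R]_N) (i : 'I_M) (j : 'I_N),
       j \notin S i -> j != row_idx ltMN i -> b U (row_idx ltMN i) j = 0)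
    (A1_continuous : forall (i : 'I_M) (j : 'I_N),
       continuous (fun U : 'rV[R]_N =>
         b U (row_idx ltMN i) j * (U 0 j - U 0 (row_idx ltMN i))))
    (A1_bounded : forall (i : 'I_M) (j : 'I_N), (M <= j)%N ->
       [bounded b U (row_idx ltMN i) j | U in [set: 'rV[R]_N]%classic])
    (A2 : forall (U : 'rV[R]_N) (i : 'I_M),
       (forall j : 'I_N, j \in S i -> U 0 (row_idx ltMN i) > U 0 j) \/
       (forall j : 'I_N, j \in S i -> U 0 (row_idx ltMN i) < U 0 j) ->
       forall j : 'I_N, j \in S i -> a i j + b U (row_idx ltMN i) j <= 0)
    (U : 'rV[R]_N)
    (U_sol : forall i : 'I_M,
       \sum_(j < N) (a i j + b U (row_idx ltMN i) j) * U 0 j = g i) :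
  [/\ (forall i : 'I_M, g i <= 0) ->
        (max_over xpredT (fun i => U 0 i)%R
         <= max_over (fun i : 'I_N => (M <= i)%N)
              (fun i => pos_part (U 0 i))%R)%E,
      (forall i : 'I_M, 0 <= g i) ->
        (min_over (fun i : 'I_N => (M <= i)%N)
              (fun i => neg_part (U 0 i))%R
         <= min_over xpredT (fun i => U 0 i)%R)%E
    & (forall i : 'I_M, \sum_(j < N) a i j = 0) ->
      ((forall i : 'I_M, g i <= 0) ->
         max_over xpredT (fun i => U 0 i)
         = max_over (fun i : 'I_N => (M <= i)%N) (fun i => U 0 i)) /\
      ((forall i : 'I_M, 0 <= g i) ->
         min_over xpredT (fun i => U 0 i)
         = min_over (fun i : 'I_N => (M <= i)%N) (fun i => U 0 i))].
Proof.
(* The scalar [c] handles both extrema at once: it is later taken to be 1 for the maximum and -1 for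
   the minimum. Off the diagonal and outside [S i], both [a] and [b U] vanish. *)
have sgn (c : R) i (W := fun l => c * U 0 l) : c != 0 ->
    (forall l, W l <= W (row_idx ltMN i)) -> forall j,
    0 <= (a i j + b U (row_idx ltMN i) j) * (W j - W (row_idx ltMN i)).
  move=> c0 Wmax j; rewrite /W -mulrBr mulrCA.
  have [->|ji] := eqVneq j (row_idx ltMN i); first by rewrite subrr !mulr0.
  have [jS|jS] := boolP (j \in S i); last first.
    rewrite b_supp // addr0; have -> : a i j = 0.
      by apply/eqP; apply: contraNT jS; exact: S_lower.
    by rewrite mul0r mulr0.
  apply: (weak_extremum_sign (b := fun V => b V (row_idx ltMN i) j)
            (S_upper i) jS (A1_continuous i j)) => //.
    by move=> V Vext; exact: A2 Vext _ jS.
  by move=> l _; rewrite mulrBr subr_ge0; exact: Wmax.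
have attained (c : R) (k0 : 'I_N) : c != 0 -> (forall i, c * g i <= 0) ->
    (forall j, c * U 0 j <= c * U 0 k0) ->
    0 < c * U 0 k0 \/ (forall i, \sum_(j < N) a i j = 0) ->
    exists2 k : 'I_N, (M <= k)%N & U 0 k = U 0 k0.
  move=> c0 cg Uk0 hs.
  (* The matrix stays frozen at [b U] while the vector is scaled to [c * U], so the system remains
     linear, with right-hand side [c * g i]. *)
  have [||||k Mk Uk] := @max_attained_outside_rows R M N ltMN a
      (\matrix_(i, j) b U (row_idx ltMN i) j) (fun l => c * U 0 l) k0
      a_row_ge0 a_posdef _ _ _ _ Uk0 hs.
  - by move=> i j ij; rewrite mxE; exact: b_offdiag.
  - by move=> i; under eq_bigr do rewrite mxE.
  - by move=> i Ui j; rewrite mxE; exact: sgn.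
  - move=> i; under eq_bigr do rewrite mxE mulrCA.
    by rewrite -mulr_sumr U_sol.
  - by exists k => //; exact: (mulfI c0).
(* The index of value [M], the first one beyond the rows, shows that the maxima and minima over
   those indices are not taken over an empty set. *)
pose kN : 'I_N := Ordinal ltMN.
have [kmax _ maxP] := @arg_maxP _ R 'I_N kN xpredT (fun l => U 0 l) isT.
have [kmin _ minP] := @arg_minP _ R 'I_N kN xpredT (fun l => U 0 l) isT.
have ub j : U 0 j <= U 0 kmax by exact: maxP.
have lb j : U 0 kmin <= U 0 j by exact: minP.
have maxA := attained 1 kmax (oner_neq0 R).
have minA := attained (-1) kmin.
rewrite !mul1r in maxA; rewrite !mulN1r in minA.
have {}maxA : (forall i, g i <= 0) ->
    0 < U 0 kmax \/ (forall i, \sum_(j < N) a i j = 0) ->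
    exists2 k : 'I_N, (M <= k)%N & U 0 k = U 0 kmax.
  by move=> g0; apply: maxA => i; rewrite mul1r.
have {}minA : (forall i, 0 <= g i) ->
    U 0 kmin < 0 \/ (forall i, \sum_(j < N) a i j = 0) ->
    exists2 k : 'I_N, (M <= k)%N & U 0 k = U 0 kmin.
  move=> g0 hs; apply: minA; rewrite ?oppr_eq0 ?oner_neq0 ?oppr_gt0 //.
    by move=> i; rewrite mulN1r oppr_le0.
  by move=> j; rewrite !mulN1r lerN2.
split.
- move=> g0; apply/bigmax_leP; split; first exact: leNye.
  (* A nonpositive maximum lies below any positive part, so [kN] serves as witness; a positive one
     is attained beyond the rows. *)
  move=> j _; have [s_le0|s_gt0] := leP (U 0 kmax) 0.
    apply: (Order.TotalTheory.bigmax_sup kN) => //.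
    by rewrite lee_fin /pos_part le_max (le_trans (ub j) s_le0) orbT.
  have [k Mk Uk] := maxA g0 (or_introl s_gt0).
  apply: (Order.TotalTheory.bigmax_sup k) => //.
  by rewrite lee_fin /pos_part Uk le_max ub.
- move=> g0; apply/bigmin_geP; split; first exact: leey.
  move=> j _; have [s_ge0|s_lt0] := leP 0 (U 0 kmin).
    apply: (bigmin_inf kN) => //.
    by rewrite lee_fin /neg_part ge_min (le_trans s_ge0 (lb j)) orbT.
  have [k Mk Uk] := minA g0 (or_introl s_lt0).
  apply: (bigmin_inf k) => //.
  by rewrite lee_fin /neg_part Uk ge_min lb.
(* Zero row sums replace the sign condition on the extremum, which is therefore attained beyond the
   rows; the other inequality is monotonicity in the index set. *)
- move=> a0; split=> g0; apply/eqP; rewrite eq_le; apply/andP; split.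
  + have [k Mk Uk] := maxA g0 (or_intror a0).
    apply/bigmax_leP; split=> [|j _]; first exact: leNye.
    by apply: (Order.TotalTheory.bigmax_sup k) => //; rewrite lee_fin Uk.
  + by apply: sub_bigmax.
  + by apply: sub_bigmin.
  + have [k Mk Uk] := minA g0 (or_intror a0).
    apply/bigmin_geP; split=> [|j _]; first exact: leey.
    by apply: (bigmin_inf k) => //; rewrite lee_fin Uk.
Qed.
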